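(* Let $T$ be a directed tree of order $n\ge2$ with $e$ end-vertices and $p$ penultimate vertices. Then $\gamma^t_{\times2}(T)\ge\frac{2n+e-p+2}{3}$, and equality holds if and only if $T\in\Gamma$.
   Context: A directed tree is a digraph whose underlying graph is a tree; a directed star is an orientation of a star $K_{1,m}$ with arbitrary arc directions. An end-vertex is a vertex $v$ with $\deg^+(v)+\deg^-(v)=1$; a penultimate vertex is a vertex adjacent (in either direction) with an end-vertex. A total $2$-dominating set is a set $S\subseteq V(T)$ such that the induced subdigraph $T\langle S\rangle$ has no isolated vertices and every vertex of $V(T)\setminus S$ has at least two in-neighbours in $S$; $\gamma^t_{\times2}(T)$ is its minimum size. For a vertex set $X$ of a digraph $H$, $N^-_H(X)$ is the set of in-neighbours of vertices of $X$, and $N_H[X]=\bigcup_{x\in X}(N^-_H[x]\cup N^+_H[x])$. The family $\Gamma$: let $F_0$ be a directed forest consisting of $r\ge0$ copies of the directed path $P_2$ with arcs $(v_{11},v_{12}),\dots,(v_{r1},v_{r2})$ and $r'\ge0$ directed stars $H_1,\dots,H_{r'}$, each of order at least $3$, with central vertices $u_1,\dots,u_{r'}$ ($r+r'\ge1$). Let $q=r+r'-1$ and $A=\{v_{i1},v_{i2}\}_{i=1}^r\cup\{u_i\}_{i=1}^{r'}$. $F_1$ is obtained from $F_0$ by adding a new vertex $w_1$ and arcs $(x_1,w_1),(y_1,w_1)$ for some $x_1,y_1\in A$ not in the same $P_2$-copy. For $2\le j\le q$, $F_j$ is obtained from $F_{j-1}$ by adding a new vertex $w_j$ and arcs $(x_j,w_j),(y_j,w_j)$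 with $x_j,y_j\in A$ such that precisely one of $x_j,y_j$ belongs to $B_j=N_{F_0}[N^-_{F_{j-1}}(\{w_1,\dots,w_{j-1}\})]$. $\Gamma$ is the family of all digraphs $F_q$ so constructed. *)

(* Defs.v *)
From mathcomp Require Import all_boot all_order all_algebra.

Set Implicit Arguments.
Unset Strict Implicit.
Unset Printing Implicit Defensive.

Record digraph := Digraph { vertex :> finType; darc : rel vertex }.

Definition diso (G H : digraph) : Prop :=
  exists2 f : G -> H, bijective f & forall x y, darc (f x) (f y) = darc x y.

Section DigraphNotions.
Variable G : digraph.
Implicit Types (u v x : G) (S X : {set G}).

Definition adj : rel G := [rel u v | darc u v || darc v u].

Definition in_nbrs v : {set G} := [set u | darc u v].
Definition out_nbrs v : {set G} := [set u | darc v u].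

Definition in_nbhd X : {set G} := \bigcup_(x in X) in_nbrs x.
Definition closed_nbhd X : {set G} :=
  \bigcup_(x in X) ((x |: in_nbrs x) :|: (x |: out_nbrs x)).

Definition end_vertices : {set G} :=
  [set v | #|out_nbrs v| + #|in_nbrs v| == 1].
Definition penultimate_vertices : {set G} :=
  [set v | [exists u in end_vertices, adj u v]].

Definition total_2_dominating S : bool :=
  [forall v in S, exists u in S, adj u v] &&
  [forall v in ~: S, 2 <= #|in_nbrs v :&: S|].

(* If any total 2-dominating set exists, then G has no isolated vertex and
   [set: G] is one, so the starting point of the arg min is harmless. *)
Definition gamma_t2 : nat :=
  #|[arg min_(S < [set: G] | total_2_dominating S) #|S|]|.

End DigraphNotions.

Definition is_tree (V : finType) (e : rel V) : Prop :=
  [/\ 0 < #|V|,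
      forall x y, connect e x y
    & forall c : seq V, ucycle e c -> size c <= 2].

(* Two opposite arcs give two parallel edges, i.e. a cycle, in the underlying
   graph; a directed tree is thus an orientation of a tree. The case x = y
   excludes loops. *)
Definition oriented (G : digraph) : Prop :=
  forall x y : G, ~~ (darc x y && darc y x).

Definition directed_tree (G : digraph) : Prop :=
  oriented G /\ is_tree (@adj G).

Definition directed_star (H : digraph) (c : H) : Prop :=
  oriented H /\
  forall x y : H, adj x y = (x != y) && ((x == c) || (y == c)).

Section GammaConstruction.
Variables (r r' : nat) (H : 'I_r' -> digraph) (c : forall k, H k).

(* inl (i, false) and inl (i, true) are the tail and the head of the i-th copy
   of P_2; inr (Tagged _ h) is the vertex h of the k-th star H k, whose centre
   is c k. *)
Definition F0_vertex : finType := ('I_r * bool + {k : 'I_r' & H k})%type.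

Definition F0_arc (u v : F0_vertex) : bool :=
  match u, v with
  | inl (i, a), inl (j, b) => [&& i == j, ~~ a & b]
  | inr s, inr t => (tag s == tag t) && darc (tagged s) (tagged_as s t)
  | _, _ => false
  end.

Definition F0 : digraph := Digraph F0_arc.

Definition A_set : {set F0} :=
  [set u : F0_vertex | match u with
                       | inl _ => true
                       | inr s => tagged s == c (tag s)
                       end].

Definition same_P2 (u v : F0) : bool :=
  match (u : F0_vertex), (v : F0_vertex) with
  | inl (i, _), inl (j, _) => i == j
  | _, _ => false
  end.

(* Indices start at 0: the vertex inr i of F j (i < j) is w_(i+1), whose
   in-neighbours are x i = x_(i+1) and y i = y_(i+1). Thus F j is F_j, obtained
   from F_(j-1) by adding w_j and its two arcs. *)
Variables x y : nat -> F0.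

Definition F_vertex (j : nat) : finType := (F0 + 'I_j)%type.

Definition F_arc (j : nat) (u v : F_vertex j) : bool :=
  match u, v with
  | inl a, inl b => darc a b
  | inl a, inr i => (a == x i) || (a == y i)
  | inr _, _ => false
  end.

Definition F (j : nat) : digraph := Digraph (@F_arc j).

(* B j is the set B_(j+1), which constrains the choice of x_(j+1), y_(j+1).
   The in-neighbours of the w's all lie in F0, so pulling them back along inl
   loses nothing. *)
Definition B (j : nat) : {set F0} :=
  closed_nbhd [set a : F0 |
    (inl a : F j) \in in_nbhd [set (inr i : F j) | i : 'I_j]].

Definition admissible (q : nat) : Prop :=
  [/\ forall j, j < q -> (x j \in A_set) && (y j \in A_set),
      0 < q -> (x 0 != y 0) && ~~ same_P2 (x 0) (y 0)
    & forall j, 0 < j < q -> (x j \in B j) (+) (y j \in B j)].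

End GammaConstruction.

(* The family is closed under isomorphism of digraphs. *)
Definition Gamma (T : digraph) : Prop :=
  exists (r r' : nat) (H : 'I_r' -> digraph) (c : forall k, H k)
         (x y : nat -> F0 r H),
    [/\ 0 < r + r',
        forall k, directed_star (c k) /\ 3 <= #|H k|,
        admissible c x y (r + r').-1
      & diso T (F x y (r + r').-1)].

(* Main.v *)
(** Let [S] be a total 2-dominating set of a directed tree. It contains every
    end-vertex and every penultimate vertex, so each [v] in [S] has at least one
    neighbour in [S], and at least as many as it has end-vertex neighbours;
    summing over [S], twice the number of arcs inside [S] is at least
    [#|S| + e - p]. Each of the [n - #|S|] vertices outside [S] receives two
    arcs from [S], and the tree has fewer than [n] arcs in all: this is the
    bound.

    In the equality case a vertex of [S] with two neighbours in [S] has only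
    end-vertices as such neighbours, so the components of [S] are stars and
    copies of P_2, and a vertex outside [S] has no other arc than two arcs from
    [S]. Counting arcs again, the outside vertices are one fewer than the
    components, and connectedness lets us list them so that each one attaches a
    new component, as in the construction of Gamma. Conversely, the vertices of
    [F_0] form a total 2-dominating set of [F_q] whose size is the bound. *)

Require Import Defs.
From mathcomp Require Import all_boot all_order all_algebra.
From mathcomp Require Import zify lra.

Set Implicit Arguments.
Unset Strict Implicit.
Unset Printing Implicit Defensive.

(** * Arcs of oriented acyclic graphs *)

Section Counting.
Variable G : digraph.
Implicit Types (u v w : G) (S W : {set G}).

Definition nbrs v : {set G} := [set u | adj u v].

Lemma adj_sym : symmetric (@adj G).
Proof. by move=> u v; rewrite /adj /= orbC. Qed.

Hypothesis oG : oriented G.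

Lemma darc_irr v : darc v v = false.
Proof. by apply/negP => h; move: (oG v v); rewrite h. Qed.

Lemma darc_asym u v : darc u v -> darc v u = false.
Proof. by move=> h; apply/negP => h'; move: (oG u v); rewrite h h'. Qed.

Lemma adj_irr v : adj v v = false.
Proof. by rewrite /adj /= darc_irr. Qed.

Lemma card_nbrsI v W :
  #|nbrs v :&: W| = #|in_nbrs v :&: W| + #|out_nbrs v :&: W|.
Proof.
have -> : nbrs v :&: W = (in_nbrs v :&: W) :|: (out_nbrs v :&: W).
  by apply/setP => u; rewrite !inE /adj /= -andb_orl.
rewrite cardsU -[RHS]subn0; congr (_ - _); apply/eqP; rewrite cards_eq0.
apply/eqP/setP => u; rewrite !inE; apply/negP => /andP[/andP[h _] /andP[h' _]].
by move: (oG u v); rewrite h h'.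
Qed.

Lemma end_vertexE v : (v \in end_vertices G) = (#|nbrs v| == 1).
Proof.
rewrite inE -[nbrs v]setIT card_nbrsI !setIT; congr (_ == _); exact: addnC.
Qed.

Lemma end_vertex_nbr u v w :
  u \in end_vertices G -> adj v u -> adj w u -> v = w.
Proof.
rewrite end_vertexE => /cards1P[z nz] av aw.
have : v \in nbrs u by rewrite inE.
have : w \in nbrs u by rewrite inE.
by rewrite nz !inE => /eqP-> /eqP->.
Qed.

Lemma card_setI_sum (P : pred G) W :
  #|[set u | P u] :&: W| = \sum_(u in W) P u.
Proof.
rewrite -sum1_card big_mkcond [RHS]big_mkcond /=; apply: eq_bigr => u _.
by rewrite !inE; case: (P u); case: (u \in W).
Qed.

Lemma sum_in_out W :
  \sum_(v in W) #|in_nbrs v :&: W| = \sum_(v in W) #|out_nbrs v :&: W|.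
Proof.
under eq_bigr do rewrite card_setI_sum.
under [RHS]eq_bigr do rewrite card_setI_sum.
by rewrite exchange_big.
Qed.

Lemma sum_nbrs W :
  \sum_(v in W) #|nbrs v :&: W| = (\sum_(v in W) #|in_nbrs v :&: W|).*2.
Proof.
under eq_bigr do rewrite card_nbrsI.
by rewrite big_split /= -sum_in_out addnn.
Qed.

Hypothesis acyclic : forall c : seq G, ucycle (@adj G) c -> size c <= 2.

Lemma low_degree_vertex W :
  W != set0 -> exists2 v, v \in W & #|nbrs v :&: W| <= 1.
Proof.
move=> /set0Pn[v0 v0W].
case: (pickP [pred v | (v \in W) && (#|nbrs v :&: W| <= 1)]) => [v /andP[]|noW].
  by exists v.
have deg2 v : v \in W -> 1 < #|nbrs v :&: W|.
  by move=> vW; move: (noW v); rewrite /= vW ltnNge => /negbT.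
(* Every simple path can be prolonged at its head, since a head all of whose
   neighbours lie on the path would close a cycle. *)
suff long m : exists x p,
    [/\ size p = m, uniq (x :: p), path (@adj G) x p & all [in W] (x :: p)].
  have [x [p [sp up _ _]]] := long #|G|.
  by have := max_card [in x :: p]; rewrite (card_uniqP up) /= sp ltnn.
elim: m => [|m [x [p [sp up pp aW]]]].
  by exists v0, [::]; split=> //=; rewrite v0W.
have xW : x \in W by case/andP: aW.
case: (pickP [pred u | (u \in nbrs x :&: W) && (u \notin x :: p)]) => [u|noext].
  rewrite /= => /andP[]; rewrite !inE => /andP[aux uW] unotin.
  exists u, (x :: p); split=> //=.
  - by rewrite sp.
  - by rewrite inE unotin.
  - by rewrite aux.
  - by rewrite uW.
have inp u : u \in nbrs x :&: W -> u \in p.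
  move=> un; move: (noext u); rewrite /= un /= => /negbFE.
  by rewrite inE => /predU1P[ux|//]; move: un; rewrite ux !inE adj_irr.
have /card_gt1P[u1 [u2 [n1 n2 u12]]] := deg2 _ xW.
case: p => [|y p] in sp up pp aW noext inp *; first by have := inp _ n1.
(* Of two distinct neighbours of [x] on the path at most one is [y]. Another one, [u], closes a
   cycle through [x], [y] and [u], which has at least three vertices. *)
have [u un up'] : exists2 u, u \in nbrs x :&: W & u \in p.
  have := inp _ n1; rewrite inE => /predU1P[e1|]; last by exists u1.
  have := inp _ n2; rewrite inE => /predU1P[e2|]; last by exists u2.
  by rewrite e1 e2 eqxx in u12.
case/splitPr: up' => p1 p2 in sp up pp aW noext inp *.
suff /acyclic : ucycle (@adj G) (x :: y :: rcons p1 u).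
  by rewrite /= size_rcons.
rewrite -cat_rcons in up pp; apply/andP; split.
  move: pp; rewrite /= => /andP[-> /=]; rewrite cat_path => /andP[pp _].
  rewrite rcons_path pp last_rcons.
  by move: un; rewrite !inE => /andP[].
by move: up; rewrite -!cat_cons cat_uniq => /andP[].
Qed.

(** Induction on the size of [W]: deleting a vertex with at most one neighbour in [W] loses at most
    one arc, and a single vertex carries none. *)
Lemma acyclic_arcs W :
  W != set0 -> \sum_(v in W) #|in_nbrs v :&: W| < #|W|.
Proof.
have [m] := ubnP #|W|; elim: m W => // m IH W Wm W0.
have [v vW dv] := low_degree_vertex W0.
have [W1|W1] := eqVneq (W :\ v) set0.
  have -> : W = [set v] by rewrite -(setD1K vW) W1 setU0.
  rewrite big_set1 cards1 ltnS leqn0 cards_eq0; apply/eqP/setP => u.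
  by rewrite !inE; apply/negP => /andP[h /eqP e]; rewrite e darc_irr in h.
have cW := cardsD1 v W; rewrite vW in cW.
have {IH} IH : \sum_(u in W :\ v) #|in_nbrs u :&: (W :\ v)| < #|W :\ v|.
  by apply: IH => //; lia.
rewrite (big_setD1 v vW) /=.
(* The arcs into [W :\ v] that the smaller set misses are those leaving [v]. *)
have -> : \sum_(u in W :\ v) #|in_nbrs u :&: W| =
   \sum_(u in W :\ v) #|in_nbrs u :&: (W :\ v)| + #|out_nbrs v :&: W|.
  have -> : #|out_nbrs v :&: W| = \sum_(u in W :\ v) darc v u.
    by rewrite card_setI_sum (big_setD1 v vW) /= darc_irr.
  rewrite -big_split /=; apply: eq_bigr => u _.
  rewrite !card_setI_sum (big_setD1 v vW) /=; exact: addnC.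
by move: dv; rewrite card_nbrsI; lia.
Qed.

(** * Total 2-dominating sets: the lower bound and its equality case *)

(* The last clause says that the arcs inside S and the two arcs into each vertex
   outside S add up to #|G| - 1. *)
Definition tight S :=
  [/\ forall v, v \in S -> in_nbrs v \subset S,
      forall w, w \notin S -> in_nbrs w \subset S /\ #|in_nbrs w| = 2,
      forall v, v \in S -> 0 < #|nbrs v :&: S|,
      forall u v, v \in S -> 1 < #|nbrs v :&: S| -> u \in nbrs v :&: S ->
        u \in end_vertices G
    & \sum_(v in S) #|nbrs v :&: S| + 2 * #|~: S| + 2 = 2 * #|S| ].

Hypothesis G_gt0 : 0 < #|G|.

(** Outside [S] two in-neighbours would be required, but an end-vertex has only one neighbour. *)
Lemma t2_end S v : total_2_dominating S -> v \in end_vertices G -> v \in S.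
Proof.
case/andP=> _ /forall_inP dom; rewrite end_vertexE => /eqP nv.
apply/negPn/negP => vS; have := dom v; rewrite inE => /(_ vS).
apply/negP; rewrite -ltnNge ltnS -nv; apply/subset_leq_card/subsetP => u.
by rewrite !inE /adj /= => /andP[->].
Qed.

Lemma t2_nbr S v :
  total_2_dominating S -> v \in S -> exists2 u, u \in S & adj u v.
Proof.
by case/andP=> /forall_inP tot _ /tot /exists_inP[u uS a]; exists u.
Qed.

(** An end-vertex next to [v] lies in [S] and is not isolated there, and [v] is its only
    neighbour. *)
Lemma t2_penultimate S v :
  total_2_dominating S -> v \in penultimate_vertices G -> v \in S.
Proof.
move=> tS; rewrite inE => /exists_inP[u ue auv].
have [w wS aw] := t2_nbr tS (t2_end tS ue).
by rewrite (end_vertex_nbr ue (_ : adj v u) aw) // adj_sym.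
Qed.

(** Double counting: the unique neighbour of each end-vertex lies in [S]. *)
Lemma sum_end_nbrs S : total_2_dominating S ->
  \sum_(v in S) #|nbrs v :&: end_vertices G| = #|end_vertices G|.
Proof.
move=> tS; under eq_bigr do rewrite card_setI_sum.
rewrite exchange_big /= -sum1_card; apply: eq_bigr => u ue.
have [w wS aw] := t2_nbr tS (t2_end tS ue).
rewrite (bigD1 w) //= adj_sym aw big1 ?addn0 // => v /andP[vS vw].
apply/eqP; rewrite eqb0; apply: contra vw => auv.
by apply/eqP/(end_vertex_nbr ue); rewrite // adj_sym.
Qed.

(** The three estimates [L1], [L2], [L3] are kept as [leqif] statements, so that the same
    inequalities yield both the bound and, when it is attained, the clauses of [tight]. *)
Lemma t2_bound_tight S : total_2_dominating S ->
  2 * #|G| + #|end_vertices G| + 2 <= 3 * #|S| + #|penultimate_vertices G|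
  /\ (3 * #|S| + #|penultimate_vertices G| = 2 * #|G| + #|end_vertices G| + 2
      -> tight S).
Proof.
move=> tS; have [_ /forall_inP dom] := andP tS.
have tot0 v : v \in S -> 0 < #|nbrs v :&: S|.
  move=> /(t2_nbr tS)[u uS a]; apply/card_gt0P; exists u.
  by rewrite !inE a.
have arcs : \sum_(v : G) #|in_nbrs v| < #|G|.
  have GT : [set: G] != set0 by rewrite -card_gt0 cardsT.
  have := acyclic_arcs GT; rewrite cardsT; apply: leq_ltn_trans.
  by rewrite [leqRHS]big_mkcond leq_sum // => v _; rewrite inE setIT.
have split_arcs : \sum_(v : G) #|in_nbrs v| =
    \sum_(v in S) #|in_nbrs v| + \sum_(v in ~: S) #|in_nbrs v|.
  rewrite (bigID [in S]) /=; congr addn.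
  by apply: eq_bigl => v; rewrite inE.
have L1 : \sum_(v in S) #|in_nbrs v :&: S| <= \sum_(v in S) #|in_nbrs v|
    ?= iff [forall (v | v \in S), in_nbrs v :&: S == in_nbrs v].
  by apply: leqif_sum => v _; apply: subset_leqif_cards; apply: subsetIl.
have L2 : \sum_(v in ~: S) 2 <= \sum_(v in ~: S) #|in_nbrs v|
    ?= iff [forall (v | v \in ~: S),
      (2 == #|in_nbrs v :&: S|) && (in_nbrs v :&: S == in_nbrs v)].
  apply: leqif_sum => v vS; apply: leqif_trans (subset_leqif_cards _).
    by split=> //; apply: dom.
  by apply: subsetIl.
(* A non-penultimate vertex has no end-vertex neighbour and at least one neighbour in [S]. At a
   penultimate vertex the indicator offsets the 1 on the left, and its end-vertex neighbours all lie
   in [S]. *)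
have L3 : \sum_(v in S) (1 + #|nbrs v :&: end_vertices G|)
       <= \sum_(v in S) (#|nbrs v :&: S| + (v \in penultimate_vertices G))
    ?= iff [forall (v | v \in S),
      if v \in penultimate_vertices G
      then nbrs v :&: end_vertices G == nbrs v :&: S
      else 1 == #|nbrs v :&: S|].
  apply: leqif_sum => v vS; have [vp|vp] := ifPn.
    rewrite addnC /=; have sub : nbrs v :&: end_vertices G \subset nbrs v :&: S.
      by apply: setIS; apply/subsetP => u; apply: t2_end.
    have [l e] := subset_leqif_cards sub.
    by split; [rewrite leq_add2r | rewrite eqn_add2r].
  have -> : nbrs v :&: end_vertices G = set0.
    apply/setP => u; rewrite !inE; apply: contraNF vp => /andP[a ue].
    by rewrite inE; apply/exists_inP; exists u; rewrite // inE.
  by rewrite cards0 !addn0; split=> //; apply: tot0.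
rewrite !big_split /= sum_nbrs sum1_card sum_end_nbrs // in L3.
have penE : \sum_(v in S) (v \in penultimate_vertices G) =
    #|penultimate_vertices G|.
  rewrite -(card_setI_sum [in penultimate_vertices G]); congr #|pred_of_set _|.
  apply/setP => v; rewrite inE inE andb_idr //; exact: t2_penultimate.
rewrite penE in L3; rewrite sum_nat_const in L2.
have cS := cardsC S.
(* Each reverse inequality is equivalent to its pointwise equality condition; equality in the bound
   forces all three. *)
have l1 := geq_leqif L1; have l2 := geq_leqif L2; have l3 := geq_leqif L3.
case: L1 L2 L3 => [L1 _] [L2 _] [L3 _]; split; first by lia.
move=> eq3.
have {}l1 : forall v, v \in S -> in_nbrs v :&: S == in_nbrs v.
  by move: l1; case: leqP => [_ /esym/forall_inP //|lt _]; lia.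
have {}l2 : forall v, v \in ~: S ->
    (2 == #|in_nbrs v :&: S|) && (in_nbrs v :&: S == in_nbrs v).
  by move: l2; case: leqP => [_ /esym/forall_inP //|lt _]; lia.
have {}l3 : forall v, v \in S ->
    if v \in penultimate_vertices G
      then nbrs v :&: end_vertices G == nbrs v :&: S
      else 1 == #|nbrs v :&: S|.
  by move: l3; case: leqP => [_ /esym/forall_inP //|lt _]; lia.
split=> //.
- by move=> v /l1 /eqP/setIidPl.
- move=> w wS; have := l2 w; rewrite inE => /(_ wS) /andP[/eqP c /eqP e].
  by split; [apply/setIidPl | rewrite -e -c].
- move=> u v /l3; case: ifP => [_ /eqP <- _|_ /eqP <- //].
  by rewrite inE => /andP[].
- by rewrite sum_nbrs; lia.
Qed.

End Counting.

(** * The components of a tight set *)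

Section Components.
Variables (G : digraph) (S : {set G}).
Hypotheses (oG : oriented G) (tS : tight S).
Implicit Types u v w t z : G.

Let snb v := nbrs v :&: S.

(* For v in S and S tight: the central vertex of the star, or the tail of the
   P_2, that is the component of v in S. *)
Definition comp_root v : G :=
  if 1 < #|snb v| then v else
  if [pick u in snb v] is Some u then
    if (1 < #|snb u|) || darc u v then u else v
  else v.

Lemma snb_sym u v : u \in S -> v \in S -> (u \in snb v) = (v \in snb u).
Proof. by move=> uS vS; rewrite !inE adj_sym uS vS. Qed.

Lemma snb_pos v : v \in S -> 0 < #|snb v|.
Proof. by case: tS => _ _ h _ _; apply: h. Qed.

(** By tightness [u] is an end-vertex of the whole digraph, hence a leaf attached to [v] alone. *)
Lemma centre_snb u v w :
  v \in S -> 1 < #|snb v| -> u \in snb v -> adj w u -> w = v.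
Proof.
case: tS => _ _ _ h _ vS dv uv aw.
apply: (end_vertex_nbr oG (h _ _ vS dv uv) aw).
by rewrite adj_sym; move: uv; rewrite !inE => /andP[].
Qed.

Lemma centre_snb_card u v :
  v \in S -> 1 < #|snb v| -> u \in snb v -> snb u = [set v].
Proof.
move=> vS dv uv; have uS : u \in S by move: uv; rewrite inE => /andP[].
apply/setP => w; rewrite [RHS]inE; apply/idP/eqP => [|->].
  by rewrite !inE => /andP[/(centre_snb vS dv uv)].
by rewrite -snb_sym.
Qed.

Lemma snb_le1 u v : u \in snb v -> #|snb v| <= 1 -> snb v = [set u].
Proof.
move=> uv d; apply/esym/eqP; rewrite eqEcard sub1set uv cards1; exact: d.
Qed.

Variant comp_spec v : G -> Prop :=
| CompCentre of 1 < #|snb v| : comp_spec v v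
| CompLeaf u of 1 < #|snb u| & u \in S & v \in snb u & snb v = [set u] :
    comp_spec v u
| CompTail u of darc v u & u \in S & snb v = [set u] & snb u = [set v] :
    comp_spec v v
| CompHead u of darc u v & u \in S & snb v = [set u] & snb u = [set v] :
    comp_spec v u.

(** A vertex with a single neighbour in [S] is a star leaf if that neighbour has several; otherwise
    the two form a P_2, and the direction of the arc selects the root. *)
Lemma compP v : v \in S -> comp_spec v (comp_root v).
Proof.
move=> vS; rewrite /comp_root; case: ifPn => [|dv]; first exact: CompCentre.
rewrite -leqNgt in dv; case: pickP => [u uv|no]; last first.
  by have /card_gt0P[u] := snb_pos vS; have := no u => /= ->.
have uS : u \in S by move: uv; rewrite inE => /andP[].
have vu : v \in snb u by rewrite -snb_sym.
have sv := snb_le1 uv dv.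
case: (ltnP 1 #|snb u|) => [du|du] /=; first exact: CompLeaf.
have su := snb_le1 vu du.
case: ifPn => [uav|nuav]; first exact: CompHead.
apply: (@CompTail v u) => //.
by move: uv; rewrite !inE /adj /= (negPf nuav) => /andP[].
Qed.

Lemma comp_root_centre v : 1 < #|snb v| -> comp_root v = v.
Proof. by rewrite /comp_root => ->. Qed.

Lemma comp_root_leaf u v :
  v \in S -> 1 < #|snb v| -> u \in snb v -> comp_root u = v.
Proof.
move=> vS dv uv; have su := centre_snb_card vS dv uv.
rewrite /comp_root su cards1 /=; case: pickP => [w|/(_ v)]; rewrite inE ?eqxx //.
by move=> /eqP ->; rewrite dv.
Qed.

Lemma comp_root_P2 u v : u \in S -> v \in S ->
  darc u v -> snb v = [set u] -> snb u = [set v] ->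
  comp_root u = u /\ comp_root v = u.
Proof.
move=> uS vS uv sv su.
split; rewrite /comp_root (su, sv) cards1 /=.
  case: pickP => [w|/(_ v)]; rewrite inE ?eqxx // => /eqP ->.
  by rewrite sv cards1 (darc_asym oG uv).
case: pickP => [w|/(_ u)]; rewrite inE ?eqxx // => /eqP ->.
by rewrite uv orbT.
Qed.

(** Hence [comp_root] is constant on each component of [S]. *)
Lemma comp_root_adj u v :
  u \in S -> v \in S -> adj u v -> comp_root u = comp_root v.
Proof.
move=> uS vS auv; have uv : u \in snb v by rewrite !inE auv.
have vu : v \in snb u by rewrite -snb_sym.
case: (ltnP 1 #|snb u|) => du.
  by rewrite (comp_root_leaf uS du vu) comp_root_centre.
case: (ltnP 1 #|snb v|) => dv.
  by rewrite (comp_root_leaf vS dv uv) comp_root_centre.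
have [su sv] := (snb_le1 vu du, snb_le1 uv dv).
case/orP: auv => a.
  by case: (comp_root_P2 uS vS a sv su) => -> ->.
by case: (comp_root_P2 vS uS a su sv) => -> ->.
Qed.

Lemma comp_rootS v : v \in S -> comp_root v \in S.
Proof. by move=> vS; case: (compP vS). Qed.

Lemma comp_rootK v : v \in S -> comp_root (comp_root v) = comp_root v.
Proof.
move=> vS; case: (compP vS) => [d|u du uS vu sv|u a uS sv su|u a uS sv su].
- exact: comp_root_centre.
- exact: comp_root_centre.
- by case: (comp_root_P2 vS uS a su sv).
- by case: (comp_root_P2 uS vS a sv su).
Qed.

Definition comp_roots := [set v in S | comp_root v == v].

Definition centres := [set v in S | 1 < #|snb v|].
Definition tails := comp_roots :\: centres.

Lemma centres_sub : centres \subset comp_roots.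
Proof.
by apply/subsetP => v; rewrite !inE => /andP[-> /comp_root_centre ->] /=.
Qed.

Lemma nonrootP v : v \in S -> comp_root v != v ->
  snb v = [set comp_root v] /\ v \in snb (comp_root v).
Proof.
move=> vS; case: (compP vS) => [|u du uS vu sv|u a uS sv su|u a uS sv su].
- by rewrite eqxx.
- by [].
- by rewrite eqxx.
- by rewrite su inE eqxx.
Qed.

Lemma root_snb z v : z \in comp_roots -> v \in snb z -> comp_root v = z /\ v != z.
Proof.
rewrite inE => /andP[zS /eqP rz] vz.
have [vS az] : v \in S /\ adj v z by move: vz; rewrite !inE => /andP[].
split; first by rewrite (comp_root_adj vS zS az).
by apply: contraTneq az => ->; rewrite adj_irr.
Qed.

(** A non-root has its root as only neighbour in [S], and the neighbours of a root in [S] are the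
    non-roots it represents. Roots and non-roots thus each contribute the number of non-roots. *)
Lemma sum_snb : \sum_(v in S) #|snb v| + 2 * #|comp_roots| = 2 * #|S|.
Proof.
have sub : comp_roots \subset S by apply/subsetP => v; rewrite inE => /andP[].
have cS := cardsID comp_roots S; rewrite (setIidPr sub) in cS.
have -> : \sum_(v in S) #|snb v| =
    \sum_(v in comp_roots) #|snb v| + \sum_(v in S :\: comp_roots) #|snb v|.
  by rewrite (big_setID comp_roots) /= (setIidPr sub).
have -> : \sum_(v in S :\: comp_roots) #|snb v| = #|S :\: comp_roots|.
  rewrite -sum1_card; apply: eq_bigr => v; rewrite !inE => /andP[nr vS].
  rewrite vS /= in nr; case: (nonrootP vS nr) => -> _; exact: cards1.
have -> : \sum_(v in comp_roots) #|snb v| = #|S :\: comp_roots|.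
  rewrite -[RHS]sum1_card [RHS](partition_big comp_root [in comp_roots]) /=.
    apply: eq_bigr => z zR; rewrite -sum1_card; apply: eq_bigl => v.
    apply/idP/idP => [vz|].
      have [rv vz'] := root_snb zR vz.
      have vS : v \in S by move: vz; rewrite inE => /andP[].
      by rewrite !inE vS rv eqxx /= !andbT eq_sym.
    rewrite !inE => /andP[/andP[nr vS] /eqP rv]; rewrite vS /= in nr.
    by have [_] := nonrootP vS nr; rewrite rv !inE.
  move=> v; rewrite !inE => /andP[_ vS].
  by rewrite comp_rootS //= comp_rootK.
lia.
Qed.

(** Compares the degree sum in [tight], which comes from the arc count, with the one computed from
    the components. *)
Lemma card_outside : #|~: S|.+1 = #|comp_roots|.
Proof. by case: tS => _ _ _ _ h; have := sum_snb; rewrite /snb; lia. Qed.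

Lemma card_comp_roots : #|tails| + #|centres| = #|comp_roots|.
Proof.
by rewrite -(cardsID centres comp_roots) (setIidPr centres_sub) addnC.
Qed.

End Components.

(** * Listing the edges of a connected graph *)

(* Greedy choice of the edges {a w, b w}: each one reaches exactly one new vertex
   of K, which is why none is repeated and #|K| - 1 of them suffice. *)
Lemma connected_enumeration (K V : finType) (W : {set V}) (a b : V -> K)
    (k0 : K) :
  #|W|.+1 = #|K| ->
  (forall D : {set K}, k0 \in D -> D != setT ->
     exists2 w, w \in W & (a w \in D) (+) (b w \in D)) ->
  exists s : seq V, [/\ uniq s, size s = #|W|, {subset s <= W} &
    forall s1 w s2, s = s1 ++ w :: s2 ->
      let D := [set k | (k == k0) || has [pred v | (k == a v) || (k == b v)] s1]
      in (a w \in D) (+) (b w \in D)].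
Proof.
move=> cardW conn.
(* The vertices reached from [k0] by the listed edges; the invariant is that [m] edges reach exactly
   [m.+1] of them. *)
pose D s := [set k | (k == k0) || has [pred v | (k == a v) || (k == b v)] s].
suff step m : m <= #|W| -> exists s : seq V,
   [/\ uniq s, size s = m, {subset s <= W}, #|D s| = m.+1 &
    forall s1 w s2, s = s1 ++ w :: s2 -> (a w \in D s1) (+) (b w \in D s1)].
  by have [s [us ss sW _ sD]] := step _ (leqnn _); exists s.
elim: m => [_|m IH lt].
  exists [::]; split=> //; last by case.
  by rewrite -(cards1 k0); congr #|pred_of_set _|; apply/setP => k; rewrite !inE orbF.
have [s [us ss sW cD sD]] := IH (ltnW lt).
have [||w wW wD] := conn (D s); first by rewrite inE eqxx.
  by apply: contraTneq lt => DT; move: cD; rewrite DT cardsT; lia.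
have wD' : D (rcons s w) = a w |: (b w |: D s).
  apply/setP => k; rewrite !inE has_rcons /=.
  by case: (k == a w); case: (k == b w); case: (k == k0).
exists (rcons s w); split.
(* An edge already listed has both ends in [D s], whereas [w] has exactly one. *)
- rewrite rcons_uniq us andbT; apply: contraL wD => ws.
  have aD : a w \in D s.
    by rewrite inE; apply/orP; right; apply/hasP; exists w; rewrite //= eqxx.
  have bD : b w \in D s.
    by rewrite inE; apply/orP; right; apply/hasP; exists w; rewrite //= eqxx orbT.
  by rewrite aD bD.
- by rewrite size_rcons ss.
- by move=> v; rewrite mem_rcons inE => /predU1P[->|/sW].
- rewrite wD'; case: (boolP (a w \in D s)) wD => aD /= bD.
    by rewrite (setUidPr _) ?cardsU1 ?bD ?cD // sub1set inE aD orbT.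
  by rewrite (setUidPr (_ : [set b w] \subset _)) ?sub1set // cardsU1 aD cD.
- move=> s1 v s2; case/lastP: s2 => [|s2 u].
    by rewrite cats1 => /rcons_inj[<- <-].
  by rewrite -rcons_cons -rcons_cat => /rcons_inj[/sD].
Qed.

Lemma has_take (T : Type) (d : T) (p : pred T) (s : seq T) j :
  j <= size s -> has p (take j s) = [exists i : 'I_j, p (nth d s i)].
Proof.
move=> js; apply/(has_nthP d)/existsP => [[i]|[i pi]].
  rewrite size_takel // => ij; rewrite nth_take // => pi.
  by exists (Ordinal ij).
by exists i; rewrite ?size_takel ?nth_take.
Qed.

(** * The components of F_0 and the sets B_j *)

Section F0Components.
Variables (r r' : nat) (H : 'I_r' -> digraph) (c : forall k, H k).
Implicit Types a b z : F0 r H.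

(** The component labels serve later as the vertices of a graph whose edges are the added vertices
    w. *)
Definition F0_comp a : 'I_r + 'I_r' :=
  match a : F0_vertex r H with
  | inl p => inl p.1
  | inr s => inr (tag s)
  end.

Lemma same_P2_comp a b : same_P2 a b -> F0_comp a = F0_comp b.
Proof. by case: a b => [[i p]|s] [[j p']|t] //= /eqP ->. Qed.

Hypothesis starH : forall k, directed_star (c k).

(** A star centre, like either vertex of a P_2, is adjacent to all the rest of its component, so its
    closed neighbourhood is that component. *)
Lemma F0_closed_nbhd z a : z \in A_set r c ->
  [|| a == z, darc a z | darc z a] = (F0_comp a == F0_comp z).
Proof.
rewrite inE; case: z => [[i p]|[k h]]; case: a => [[j p']|[k' h']] //= zA.
  rewrite !(inj_eq inl_inj) xpair_eqE [i == j]eq_sym; case: (j =P i) => //= _.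
  by case: p; case: p'.
rewrite !(inj_eq inr_inj) -tag_eqE /tag_eq /= [k == k']eq_sym.
case: (k' =P k) => [e|//] /=; case: k / e in h zA *; rewrite !tagged_asE.
have := (starH k').2 h' h; rewrite (eqP zA) eqxx orbT andbT /adj /= => ->.
exact: orbN.
Qed.

(** The in-neighbours of the w's lie in A, so B_j is the union of the components already touched. *)
Lemma mem_BE (x y : nat -> F0 r H) j a :
  (forall i, i < j -> (x i \in A_set r c) && (y i \in A_set r c)) ->
  (a \in B x y j) = [exists i : 'I_j,
     (F0_comp a == F0_comp (x i)) || (F0_comp a == F0_comp (y i))].
Proof.
move=> xyA; apply/bigcupP/existsP => [[z]|[i]].
  rewrite inE => /bigcupP[w /imsetP[i _ ->]]; rewrite inE /= => zi az.
  have [xA yA] := andP (xyA i (ltn_ord i)); exists i.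
  have zA : z \in A_set r c by case/orP: zi => /eqP ->.
  have : F0_comp a == F0_comp z.
    rewrite -F0_closed_nbhd //; move: az; rewrite !inE.
    by case: (a == z); case: (darc a z); case: (darc z a).
  by case/orP: zi => /eqP -> ->; rewrite ?orbT.
have [xA yA] := andP (xyA i (ltn_ord i)) => h.
have [z [zA zi az]] : exists z, [/\ z \in A_set r c,
    (z == x i) || (z == y i) & F0_comp a == F0_comp z].
  by case/orP: h => h; [exists (x i) | exists (y i)]; rewrite eqxx ?orbT.
exists z.
  rewrite inE; apply/bigcupP; exists (inr i); first exact: imset_f.
  by rewrite inE.
move: az; rewrite -F0_closed_nbhd // !inE.
by case: (a == z); case: (darc a z); case: (darc z a).
Qed.

End F0Components.

(** * From a tight set to a member of Gamma *)

Section Decomposition.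
Variables (G : digraph) (S : {set G}).
Hypotheses (oG : oriented G) (tS : tight S).
Hypothesis conG : forall u v : G, connect (@adj G) u v.
Implicit Types u v w t : G.

Local Notation root := (comp_root S).
Local Notation snb v := (nbrs v :&: S).
Local Notation r := #|tails S|.
Local Notation r' := #|centres S|.

(** Intended for tails, whose only neighbour in [S] is the head of their P_2; the default is not
    reached there. *)
Definition mate u : G := odflt u [pick v in snb u].

Lemma tailP u : u \in tails S ->
  [/\ u \in S, mate u \in S, darc u (mate u),
      snb u = [set mate u] & snb (mate u) = [set u]].
Proof.
rewrite !inE => /andP[ncu /andP[uS /eqP ru]]; rewrite uS /= in ncu.
have mateE v : snb u = [set v] -> mate u = v.
  rewrite /mate => ->; case: pickP => [w|/(_ v)]; rewrite inE ?eqxx //.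
  by move/eqP.
move: ru; case: (compP tS uS).
- by rewrite (negPf ncu).
- by move=> v _ _ + _ e; rewrite e inE inE adj_irr.
- by move=> v a vS su sv _; rewrite (mateE _ su).
- by move=> v a vS _ _ e; move: a; rewrite e darc_irr.
Qed.

Lemma centreP z : z \in centres S -> [/\ z \in S, 1 < #|snb z| & root z = z].
Proof.
move=> zc; move: (zc); rewrite inE => /andP[zS dz]; split=> //.
exact: comp_root_centre.
Qed.

Lemma tail_root u : u \in tails S -> root u = u /\ root (mate u) = u.
Proof. by case/tailP => uS mS a su sm; apply: comp_root_P2. Qed.

Definition star_at (z : G) : digraph :=
  Digraph (fun a b : {t | (t \in S) && (root t == z)} =>
    darc (val a) (val b)).

Definition star_vertex z t (tz : (t \in S) && (root t == z)) : star_at z :=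
  exist (fun t => (t \in S) && (root t == z)) t tz.

Definition stars (k : 'I_r') : digraph := star_at (enum_val k).

Lemma star_centre_proof (k : 'I_r') :
  (enum_val k \in S) && (root (enum_val k) == enum_val k).
Proof. by case: (centreP (enum_valP k)) => -> _ ->; rewrite eqxx. Qed.

Definition star_centre k : stars k := star_vertex (star_centre_proof k).

Lemma star_atP k : directed_star (star_centre k).
Proof.
split=> [x y|x y]; first exact: oG.
have [zS dz rz] := centreP (enum_valP k).
rewrite -!val_eqE /=; set z := enum_val k in zS dz rz *.
have [/andP[xS /eqP rx] /andP[yS /eqP ry]] := (valP x, valP y).
rewrite -/z in rx ry.
have leaf (t u : G) : t \in S -> u \in S -> root t = z -> t != z -> adj t u = (u == z).
  move=> t_S uS rt tz; have ntr : root t != t by rewrite rt eq_sym.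
  have [e _] := nonrootP tS t_S ntr.
  by rewrite -in_set1 -rt -e !inE uS andbT adj_sym.
rewrite [LHS](_ : _ = adj (val x) (val y)) //.
have [xz|xz] := eqVneq (val x) z; last first.
  rewrite leaf //=; case: eqP => [->|]; last by rewrite andbF.
  by rewrite andbT.
rewrite /= andbT xz; have [yz|yz] := eqVneq (val y) z.
  by rewrite yz adj_irr // eqxx.
by rewrite adj_sym leaf // eqxx.
Qed.

Lemma card_star_at k : 3 <= #|stars k|.
Proof.
have [zS dz rz] := centreP (enum_valP k).
rewrite card_sig; set z := enum_val k in zS dz rz *.
apply: (@leq_trans #|z |: snb z|).
  by rewrite cardsU1 !inE adj_irr.
apply/subset_leq_card/subsetP => t; rewrite in_setU1 => /predU1P[->|tz].
  by rewrite inE zS rz eqxx.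
rewrite inE (comp_root_leaf oG tS zS dz tz) eqxx andbT.
by move: tz; rewrite inE => /andP[].
Qed.

Local Notation F0S := (F0 r stars).

(** Shown below to be an isomorphism of [F0S] onto the subdigraph induced by [S]. *)
Definition F0_embed (a : F0S) : G :=
  match a : F0_vertex r stars with
  | inl (i, b) => if b then mate (enum_val i) else enum_val i
  | inr s => val (tagged s)
  end.

Definition root_of (k : 'I_r + 'I_r') : G :=
  match k with inl i => enum_val i | inr k => enum_val k end.

Lemma root_of_inj : injective root_of.
Proof.
have disj (i : 'I_r) (k : 'I_r') : enum_val i <> enum_val k.
  by move=> e; have := enum_valP i; rewrite e inE (enum_valP k).
move=> [i|i] [j|j] /= e; first by rewrite (enum_val_inj e).
- by case: (disj i j).
- by case: (disj j i).
- by rewrite (enum_val_inj e).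
Qed.

Lemma F0_embedS a : F0_embed a \in S.
Proof.
case: a => [[i b]|[k h]] /=; last by case/andP: (valP h).
by case: (tailP (enum_valP i)) => uS mS _ _ _; case: b.
Qed.

Lemma F0_embed_root a : root (F0_embed a) = root_of (F0_comp a).
Proof.
case: a => [[i b]|[k h]] /=; last by case/andP: (valP h) => _ /eqP.
by case: (tail_root (enum_valP i)) => ru rm; case: b.
Qed.

Lemma F0_embed_inj : injective F0_embed.
Proof.
move=> a b e; have : F0_comp a = F0_comp b.
  by apply: root_of_inj; rewrite -!F0_embed_root e.
case: a b e => [[i p]|[k h]] [[j p']|[k' h']] //= e [ij].
  rewrite -{j}ij in e *.
  have [_ _ ar _ _] := tailP (enum_valP i).
  by case: p p' e ar => [] [] // => [->|<-]; rewrite darc_irr.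
case: k' / ij in h' e *; congr inr; congr Tagged; exact: val_inj.
Qed.

Lemma F0_embed_surj t : t \in S -> exists a, F0_embed a = t.
Proof.
move=> t_S; have rt : root t \in comp_roots S.
  by rewrite inE comp_rootS //= comp_rootK.
have [zc|zc] := boolP (root t \in centres S).
  pose k := enum_rank_in zc (root t).
  have ek : enum_val k = root t by exact: enum_rankK_in.
  have tk : (t \in S) && (root t == enum_val k) by rewrite t_S ek eqxx.
  by exists (inr (Tagged (fun k => stars k) (star_vertex tk : stars k))).
have zt : root t \in tails S by rewrite inE zc.
pose i := enum_rank_in zt (root t).
have ei : enum_val i = root t by exact: enum_rankK_in.
have [_ _ _ su _] := tailP zt.
have [e|ne] := eqVneq (root t) t; first by exists (inl (i, false)); rewrite /= ei.
have [_] := nonrootP tS t_S ne; rewrite su inE => /eqP ->.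
by exists (inl (i, true)); rewrite /= ei.
Qed.

Lemma F0_embed_adj a b : adj (F0_embed a) (F0_embed b) -> F0_comp a = F0_comp b.
Proof.
move=> ab; apply: root_of_inj; rewrite -!F0_embed_root.
by apply: comp_root_adj ab; rewrite ?F0_embedS.
Qed.

Lemma F0_embed_arc a b : darc (F0_embed a) (F0_embed b) = darc a b.
Proof.
have [e|ne] := eqVneq (F0_comp a) (F0_comp b); last first.
  transitivity false.
    by apply: contraNF ne => ab; rewrite (@F0_embed_adj a b) // /adj /= ab.
  apply/esym/negP; move: ne.
  case: a b => [[i p]|[k h]] [[j p']|[k' h']] //=.
    by rewrite (inj_eq inl_inj) => /negPf ->.
  by rewrite (inj_eq inr_inj) => /negPf ->.
case: a b e => [[i p]|[k h]] [[j p']|[k' h']] //= [e].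
  rewrite -{j}e /F0_arc eqxx /=; have [_ _ ar _ _] := tailP (enum_valP i).
  by case: p p' => [] []; rewrite ?darc_irr ?ar ?(darc_asym oG ar).
by case: k' / e in h' *; rewrite /F0_arc /= eqxx /= tagged_asE.
Qed.

(** A star leaf is an end-vertex whose only neighbour is its centre, so it sends no arc out of
    [S]. *)
Lemma F0_embed_A a w : w \notin S -> darc (F0_embed a) w -> a \in A_set r star_centre.
Proof.
move=> wS aw; rewrite inE; case: a aw => [//|[k h]] /= aw.
have [zS dz rz] := centreP (enum_valP k).
have /andP[hS /eqP rh] := valP h.
apply/eqP/val_inj => /=; apply/eqP/negPn/negP => hz.
have ne : root (val h) != val h by rewrite rh eq_sym.
have [_ hz'] := nonrootP tS hS ne; rewrite rh in hz'.
have wz : w = enum_val k.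
  by apply: (centre_snb oG tS zS dz hz'); rewrite /adj /= aw orbT.
by rewrite wz zS in wS.
Qed.

Lemma outside_out w t : w \notin S -> darc w t = false.
Proof.
move=> wS; apply: contraNF wS => wt; case: tS => h1 h2 _ _ _.
have sub : in_nbrs t \subset S.
  by have [/h1|/h2[]] := boolP (t \in S).
by apply: (subsetP sub); rewrite inE.
Qed.

Lemma outside_in : exists X : G -> F0S * F0S, forall w, w \notin S ->
  in_nbrs w = [set F0_embed (X w).1; F0_embed (X w).2].
Proof.
suff h w : exists p : F0S * F0S, w \notin S ->
    in_nbrs w = [set F0_embed p.1; F0_embed p.2].
  exact: fin_all_exists h.
(* For [w] in [S] any pair will do; [w] itself shows that [F0S] is inhabited. *)
have [wS|wS] := boolP (w \in S).
  by have [a _] := F0_embed_surj wS; exists (a, a).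
case: tS => _ /(_ w wS) [sub /eqP/cards2P[u [v [_ e]]]] _ _ _.
have [a ea] : exists a, F0_embed a = u.
  by apply/F0_embed_surj/(subsetP sub); rewrite e !inE eqxx.
have [b eb] : exists b, F0_embed b = v.
  by apply/F0_embed_surj/(subsetP sub); rewrite e !inE eqxx orbT.
by exists (a, b); rewrite /= ea eb.
Qed.

(** Take the components of [S] as vertices and let each [w] outside [S] join the components of its
    two in-neighbours. This graph is connected because [G] is, and it has one edge fewer than
    vertices, so [connected_enumeration] gives the order in which the w's are added. *)
Lemma tight_Gamma : Gamma G.
Proof.
have [X XE] := outside_in.
have XA w : w \notin S ->
    ((X w).1 \in A_set r star_centre) && ((X w).2 \in A_set r star_centre).
  move=> wS; apply/andP; split; apply: (F0_embed_A wS);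
    by have := set21 (F0_embed (X w).1) (F0_embed (X w).2);
       have := set22 (F0_embed (X w).1) (F0_embed (X w).2);
       rewrite -XE // !inE.
have cardK : #|~: S|.+1 = #|{: 'I_r + 'I_r'}|.
  by rewrite card_sum !card_ord card_comp_roots card_outside.
have rr' : 0 < r + r' by rewrite card_comp_roots -card_outside.
have /card_gt0P[k0 _] : 0 < #|{: 'I_r + 'I_r'}| by rewrite -cardK.
pose a0 : 'I_r + 'I_r' -> F0S := fun k => match k with
  | inl i => inl (i, false)
  | inr k => inr (Tagged (fun k => stars k) (star_centre k)) end.
have a0K k : F0_comp (a0 k) = k by case: k.
(* A vertex of [S] gets its own component, a vertex outside that of its first in-neighbour. If no
   edge left [D], membership of the label in [D] would be constant along arcs, hence on all of
   [G]. *)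
pose lab t : 'I_r + 'I_r' :=
  if t \in S then F0_comp (odflt (a0 k0) [pick a | F0_embed a == t])
  else F0_comp (X t).1.
have labS a : lab (F0_embed a) = F0_comp a.
  rewrite /lab F0_embedS; case: pickP => [b /= /eqP/F0_embed_inj -> //|].
  by move/(_ a); rewrite eqxx.
have conn (D : {set 'I_r + 'I_r'}) : k0 \in D -> D != setT ->
     exists2 w, w \in ~: S & (F0_comp (X w).1 \in D) (+) (F0_comp (X w).2 \in D).
  move=> k0D DT; case: (pickP [pred w | (w \in ~: S) &&
      ((F0_comp (X w).1 \in D) (+) (F0_comp (X w).2 \in D))]) => [w /andP[]|no].
    by exists w.
  have stepS t u : t \in S -> darc t u -> (lab t \in D) = (lab u \in D).
    move=> /F0_embed_surj [a <-] au; rewrite labS.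
    have [/F0_embed_surj[b e]|uS] := boolP (u \in S).
      rewrite -e labS (@F0_embed_adj a b) //.
      by rewrite /adj /= e au.
    rewrite /lab (negPf uS); move: (no u); rewrite /= inE uS /= => nu.
    have : F0_embed a \in in_nbrs u by rewrite inE.
    rewrite XE // !inE => /orP[] /eqP/F0_embed_inj ->; first by [].
    by move: nu; case: (_ \in D); case: (_ \in D).
  have step t u : adj t u -> (lab t \in D) = (lab u \in D).
    have out v w : darc v w -> v \in S.
      by move=> vw; apply/negPn/negP => /outside_out nv; rewrite nv in vw.
    case/orP=> a; first by apply: stepS => //; apply: out a.
    by apply/esym/stepS => //; apply: out a.
  case/eqP: DT; apply/setP => k; rewrite inE -(a0K k) -labS.
  rewrite -(a0K k0) -labS in k0D; rewrite -k0D; apply/esym.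
  have cl : closed (@adj G) [pred t | lab t \in D] by move=> t u /step.
  exact: (closed_connect cl (conG _ _)).
have [s [us ss sS sD]] := connected_enumeration cardK conn.
pose t0 := F0_embed (a0 k0).
pose x i := (X (nth t0 s i)).1; pose y i := (X (nth t0 s i)).2.
have q_s : (r + r').-1 = size s.
  by rewrite ss card_comp_roots -card_outside.
have nthS i : i < (r + r').-1 -> nth t0 s i \notin S.
  by rewrite q_s => /(mem_nth t0) /sS; rewrite inE.
have xyA i : i < (r + r').-1 ->
    (x i \in A_set r star_centre) && (y i \in A_set r star_centre).
  by move=> /nthS /XA.
have new j : j < size s ->
    let D := [set k | (k == k0) || [exists i : 'I_j,
      (k == F0_comp (x i)) || (k == F0_comp (y i))]] in
    (F0_comp (x j) \in D) (+) (F0_comp (y j) \in D).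
  move=> js; have := sD (take j s) (nth t0 s j) (drop j.+1 s).
  rewrite -drop_nth // cat_take_drop => /(_ erefl) /=.
  by rewrite !inE !(has_take t0) // ltnW.
exists r, r', stars, star_centre, x, y; split=> //.
- by move=> k; split; [apply: star_atP | apply: card_star_at].
- split=> // [q0|j /andP[j0 jq]].
    (* Exactly one of the two components is reached at the start, so they differ. *)
    have : F0_comp (x 0) != F0_comp (y 0).
      by apply: contraTneq (new 0 _) => [e|]; rewrite /= ?e ?addbb // -q_s.
    move=> ne; apply/andP; split; first by apply: contraNneq ne => ->.
    by apply: contraNN ne => /same_P2_comp ->.
  have jA i : i < j -> (x i \in A_set r star_centre) && (y i \in A_set r star_centre).
    by move=> ij; apply: xyA; apply: ltn_trans ij jq.
  rewrite !(mem_BE star_atP _ jA).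
  have := new j; rewrite -q_s => /(_ jq) /=; rewrite !inE.
  (* B_j makes no mention of [k0]; since [j > 0] and the first edge touches [k0], the reached set is
     the same without that clause. *)
  have k0j k : (k == k0) -> [exists i : 'I_j,
      (k == F0_comp (x i)) || (k == F0_comp (y i))].
    move=> /eqP ->; apply/existsP; exists (Ordinal j0) => /=.
    have := new 0; rewrite -q_s => /(_ (ltn_trans j0 jq)) /=; rewrite !inE.
    have no0 k' : [exists i : 'I_0,
        (k' == F0_comp (x i)) || (k' == F0_comp (y i))] = false.
      by apply/existsP => -[[]].
    by rewrite !no0 !orbF ![_ == k0]eq_sym; do 2!case: (k0 == _).
  have e k : (k == k0) || [exists i : 'I_j,
      (k == F0_comp (x i)) || (k == F0_comp (y i))] = [exists i : 'I_j,
      (k == F0_comp (x i)) || (k == F0_comp (y i))].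
    by apply/orb_idl/k0j.
  by rewrite !e.
pose h (u : F x y (r + r').-1) : G :=
  match u : F_vertex r stars (r + r').-1 with
  | inl a => F0_embed a
  | inr i => nth t0 s i
  end.
have h_inj : injective h.
  move=> [a|i] [b|j] /= e.
  - by rewrite (F0_embed_inj e).
  - by have := nthS j (ltn_ord j); rewrite -e F0_embedS.
  - by have := nthS i (ltn_ord i); rewrite e F0_embedS.
  - congr inr; apply/val_inj/eqP.
    by rewrite -(nth_uniq t0 _ _ us) ?e -?q_s ?ltn_ord //.
have h_arc (u v : F x y (r + r').-1) : darc (h u) (h v) = darc u v.
  case: u v => [a|i] [b|j] /=.
  - exact: F0_embed_arc.
  - have : (F0_embed a \in in_nbrs (nth t0 s j)) = darc (F0_embed a) (nth t0 s j).
      by rewrite inE.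
    move=> <-; rewrite XE ?nthS // !inE !(inj_eq F0_embed_inj).
    by [].
  - by rewrite outside_out ?nthS.
  - by rewrite outside_out ?nthS.
(* Cardinalities make the injection bijective: [F0_embed] covers [S], and the complement of [S] has
   as many elements as there are w's. *)
have [|h' hK h'K] := inj_card_bij h_inj.
  rewrite card_sum card_ord q_s ss -(cardsC S) leq_add2r.
  rewrite -cardsT; apply: leq_trans (leq_imset_card F0_embed _).
  apply/subset_leq_card/subsetP => t /F0_embed_surj[a <-].
  by apply: imset_f.
exists h'; first by exists h.
by move=> u v; rewrite -h_arc !h'K.
Qed.

End Decomposition.

(** * Transport along isomorphisms *)

Section Isomorphism.
Variables (G H : digraph) (f : G -> H).
Hypotheses (bij_f : bijective f)
  (f_arc : forall x y, darc (f x) (f y) = darc x y).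

Lemma iso_mem_imset (W : {set G}) (V : {set H}) :
  (forall v, (f v \in V) = (v \in W)) -> V = f @: W.
Proof.
move=> VW; have [g fK gK] := bij_f; apply/setP => u.
by rewrite -[u]gK VW mem_imset //; apply: bij_inj.
Qed.

Lemma iso_in_nbrs v : in_nbrs (f v) = f @: in_nbrs v.
Proof. by apply: iso_mem_imset => u; rewrite !inE f_arc. Qed.

Lemma iso_out_nbrs v : out_nbrs (f v) = f @: out_nbrs v.
Proof. by apply: iso_mem_imset => u; rewrite !inE f_arc. Qed.

Lemma iso_end_vertices : end_vertices H = f @: end_vertices G.
Proof.
apply: iso_mem_imset => v; rewrite !inE iso_in_nbrs iso_out_nbrs.
by rewrite !card_imset //; apply: bij_inj.
Qed.

Lemma iso_penultimate_vertices :
  penultimate_vertices H = f @: penultimate_vertices G.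
Proof.
have adjE u v : adj (f u) (f v) = adj u v by rewrite /adj /= !f_arc.
apply: iso_mem_imset => v; rewrite !inE iso_end_vertices.
apply/exists_inP/exists_inP => [[_ /imsetP[u ue ->]]|[u ue a]].
  by rewrite adjE; exists u.
by exists (f u); rewrite ?adjE ?imset_f.
Qed.

Lemma iso_oriented : oriented G -> oriented H.
Proof.
move=> oG x y; have [g fK gK] := bij_f.
by rewrite -[x]gK -[y]gK !f_arc.
Qed.

Lemma iso_total_2_dominating (S : {set G}) :
  total_2_dominating (f @: S) -> total_2_dominating S.
Proof.
have f_inj := bij_inj bij_f.
case/andP => /forall_inP tot /forall_inP dom; apply/andP; split.
  apply/forall_inP => v vS; have /exists_inP[_ /imsetP[u uS ->]] := tot _ (imset_f f vS).
  by rewrite /adj /= !f_arc => a; apply/exists_inP; exists u.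
apply/forall_inP => v; rewrite inE => vS; have := dom (f v).
rewrite inE mem_imset // => /(_ vS).
by rewrite iso_in_nbrs -imsetI ?card_imset // => ? ? _ _; apply: f_inj.
Qed.

End Isomorphism.

(** * Members of Gamma attain the bound *)

Section GammaTight.
Variables (r r' : nat) (H : 'I_r' -> digraph) (c : forall k, H k).
Variables (x y : nat -> F0 r H) (q : nat).
Hypotheses (starH : forall k, directed_star (c k))
  (cardH : forall k, 3 <= #|H k|) (adm : admissible c x y q).

Local Notation Fq := (F x y q).
Hypothesis oF : oriented Fq.

Local Notation P2 p := (inl (inl p : F0_vertex r H) : Fq).
Local Notation star k h :=
  (inl (inr (Tagged (fun k => vertex (H k)) (h : H k)) : F0_vertex r H) : Fq).

Lemma admissible_neq i : i < q -> x i != y i.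
Proof.
case: adm => _ h0 hj iq; case: i iq => [/h0 /andP[]//|i iq].
by have := hj i.+1 iq; apply: contraTneq => ->; rewrite addbb.
Qed.

Lemma P2_adj i b : adj (P2 (i, ~~ b)) (P2 (i, b)).
Proof. by rewrite /adj /= !eqxx; case: b. Qed.

Lemma star_adj k (h h' : H k) :
  adj (star k h) (star k h') = (h != h') && ((h == c k) || (h' == c k)).
Proof. by rewrite -(starH k).2 /adj /= !eqxx !tagged_asE. Qed.

Lemma star_leaves k : exists h1 h2 : H k, [/\ h1 != h2, h1 != c k & h2 != c k].
Proof.
have : 1 < #|[set~ c k]|.
  by rewrite cardsC1; have := cardH k; case: #|_| => // [[|[]]].
case/card_gt1P => h1 [h2]; rewrite !inE => -[n1 n2 n12].
by exists h1, h2.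
Qed.

Lemma w_in_nbrs (i : 'I_q) : [set (inl (x i) : Fq); inl (y i)] = in_nbrs (inr i : Fq).
Proof.
by apply/setP => -[a|j]; rewrite !inE //= !(inj_eq inl_inj).
Qed.

Lemma w_indegree (i : 'I_q) : #|in_nbrs (inr i : Fq)| = 2.
Proof. by rewrite -w_in_nbrs cards2 (inj_eq inl_inj) admissible_neq. Qed.

Lemma F0_total_2_dominating : total_2_dominating [set (inl a : Fq) | a : F0 r H].
Proof.
apply/andP; split; apply/forall_inP => v.
  case/imsetP => a _ ->{v}.
  suff [b ab] : exists b : F0 r H, adj (inl b : Fq) (inl a).
    by apply/exists_inP; exists (inl b); rewrite ?imset_f.
  case: a => [[i b]|[k h]]; first by exists (inl (i, ~~ b)); apply: P2_adj.
  have [hc|hc] := eqVneq h (c k).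
    have [h1 [_ [_ n1 _]]] := star_leaves k.
    exists (inr (Tagged (fun k => vertex (H k)) h1)).
    by rewrite star_adj hc eqxx orbT andbT.
  exists (inr (Tagged (fun k => vertex (H k)) (c k))).
  by rewrite star_adj eqxx eq_sym hc.
rewrite inE; case: v => [a|i]; first by rewrite imset_f.
rewrite (setIidPl _) ?w_indegree // -w_in_nbrs.
by apply/subsetP => u; rewrite !inE => /orP[] /eqP ->; apply: imset_f.
Qed.

(** A contains no star leaf, so no w is attached to one and the centre remains its only
    neighbour. *)
Lemma leaf_end_vertex k (h : H k) : h != c k -> star k h \in end_vertices Fq.
Proof.
move=> hc; rewrite end_vertexE //; apply/cards1P; exists (star k (c k)).
apply/setP => u; rewrite !inE; apply/idP/eqP => [|->]; last first.
  by rewrite star_adj eqxx eq_sym hc.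
case: u => [[p|[k' h']]|i].
- by rewrite /adj /= orbF; case: p.
- have [e|ne] := eqVneq k' k; last first.
    by rewrite /adj /= (negPf ne) eq_sym (negPf ne).
  case: k / e in h hc *.
  by rewrite star_adj (negPf hc) orbF => /andP[_ /eqP ->].
- case: adm => xyA _ _; have /andP[xA yA] := xyA i (ltn_ord i).
  rewrite /adj /= => /orP[] /eqP e; move: hc.
    by move: xA; rewrite -e inE /= => ->.
  by move: yA; rewrite -e inE /= => ->.
Qed.

(** The adjacent end-vertex is a star leaf or a vertex of a P_2: each w has in-degree two, and each
    centre has two leaves. *)
Lemma penultimateP u : u \in penultimate_vertices Fq ->
  (exists k, u = star k (c k)) \/
  (exists i b, u = P2 (i, ~~ b) /\ P2 (i, b) \in end_vertices Fq).
Proof.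
rewrite inE => /exists_inP[v ve]; rewrite adj_sym => av.
have nbr w : adj w v -> u = w by exact: (end_vertex_nbr oF ve av).
case: v ve av nbr => [[[i b]|[k h]]|i] ve av nbr.
- right; exists i, b; split=> //; apply: nbr => //; exact: P2_adj.
- left; exists k; have [hc|hc] := eqVneq h (c k); last first.
    by apply: nbr => //; rewrite star_adj eqxx eq_sym hc.
  have [h1 [h2 [n12 n1 n2]]] := star_leaves k.
  have e1 : u = star k h1 by apply: nbr => //; rewrite star_adj hc eqxx orbT andbT.
  have e2 : u = star k h2 by apply: nbr => //; rewrite star_adj hc eqxx orbT andbT.
  have : star k h1 == star k h2 by rewrite -e1 e2.
  by rewrite !(inj_eq inl_inj, inj_eq inr_inj) eq_Tagged /= (negPf n12).
- by move: ve; rewrite inE w_indegree addn2.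
Qed.

(** The star leaves [L] and the P_2 vertices in [EP] are distinct end-vertices, while a penultimate
    vertex is a star centre or the partner of an element of [EP]. Apart from [L], F_0 has
    [2 * r + r'] vertices. *)
Lemma card_F0_le :
  #|F0 r H| + #|penultimate_vertices Fq| <= 2 * (r + r') + #|end_vertices Fq|.
Proof.
pose EP : {set 'I_r * bool} := [set p | P2 p \in end_vertices Fq].
pose L : {set {k : 'I_r' & H k}} := [set s | tagged s != c (tag s)].
have cL : #|L| + r' = #|{: {k : 'I_r' & H k}}|.
  have inj : injective (fun k => Tagged (fun k => vertex (H k)) (c k)).
    by move=> k k' /(congr1 tag).
  rewrite -(cardsC L); congr addn; rewrite -[LHS]card_ord -(card_imset _ inj).
  congr #|pred_of_set _|; apply/setP => -[k h]; rewrite !inE negbK /=.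
  apply/imsetP/eqP => [[k' _ e]|->]; last by exists k.
  have ek : k = k' by move/(congr1 tag): e.
  by case: k' / ek e => /eqP; rewrite eq_Tagged => /eqP.
have cF : #|F0 r H| = r * 2 + (#|L| + r').
  by rewrite cL card_sum card_prod card_ord card_bool.
have endge : #|EP| + #|L| <= #|end_vertices Fq|.
  have inj1 : injective (fun p => P2 p) by move=> p p' [].
  have inj2 : injective (fun s => inl (inr s : F0_vertex r H) : Fq) by move=> s s' [].
  rewrite -(card_imset EP inj1) -(card_imset L inj2).
  have /leqifP := leq_card_setU [set P2 p | p in EP]
    [set (inl (inr s : F0_vertex r H) : Fq) | s in L].
  have -> : [disjoint [set P2 p | p in EP]
     & [set (inl (inr s : F0_vertex r H) : Fq) | s in L]].
    rewrite -setI_eq0; apply/eqP/setP => u; rewrite in_set0 inE.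
    by apply/negP => /andP[/imsetP[p _ ->] /imsetP[s _]].
  move=> /eqP <-; apply/subset_leq_card/subsetP => u.
  rewrite inE => /orP[/imsetP[p + ->]|/imsetP[[k h] + ->]]; first by rewrite inE.
  by rewrite inE /= => hc; apply: leaf_end_vertex.
have penle : #|penultimate_vertices Fq| <= r' + #|EP|.
  apply: (@leq_trans #|[set star k (c k) | k : 'I_r'] :|:
                       [set P2 (p.1, ~~ p.2) | p in EP]|).
    apply/subset_leq_card/subsetP => u /penultimateP[[k ->]|[i [b [-> e]]]].
      by rewrite inE imset_f.
    rewrite inE; apply/orP; right; apply/imsetP; exists (i, b) => //.
    by rewrite inE.
  apply: leq_trans (leq_card_setU _ _) _; apply: leq_add; last exact: leq_imset_card.
  by apply: leq_trans (leq_imset_card _ _) _; rewrite card_ord.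
by rewrite cF; lia.
Qed.

End GammaTight.

(** One inequality suffices, as the general bound supplies the other. The witness is the preimage of
    F_0, and [T] has [(r + r').-1] further vertices. *)
Lemma Gamma_dominating (T : digraph) : oriented T -> Gamma T ->
  exists2 S : {set T}, total_2_dominating S &
    3 * #|S| + #|penultimate_vertices T| <= 2 * #|T| + #|end_vertices T| + 2.
Proof.
move=> oT [r [r' [H [c [x [y [rr' hH adm [f bf farc]]]]]]]].
have starH k := (hH k).1; have cardH k := (hH k).2.
have oF := iso_oriented bf farc oT.
have f_inj := bij_inj bf.
pose S0 := [set (inl a : F x y (r + r').-1) | a : F0 r H].
have S0E : S0 = f @: (f @^-1: S0) by apply: (iso_mem_imset bf) => v; rewrite [RHS]inE.
exists (f @^-1: S0).
  apply: (iso_total_2_dominating bf farc); rewrite -S0E.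
  exact: F0_total_2_dominating.
have cS : #|f @^-1: S0| = #|F0 r H|.
  by rewrite -(card_imset _ f_inj) -S0E card_imset //; apply: inl_inj.
have cT : #|T| = #|F0 r H| + (r + r').-1.
  by rewrite (bij_eq_card bf) card_sum card_ord.
have := card_F0_le starH cardH adm oF.
rewrite (iso_end_vertices bf farc) (iso_penultimate_vertices bf farc).
by rewrite !(card_imset _ f_inj) cS cT; lia.
Qed.

(** * The bound and the equality case for directed trees *)

(** Legitimates the starting point of the arg min in [gamma_t2]: the first edge of a path to another
    vertex gives each vertex a neighbour. *)
Lemma tree_total_2_dominating (T : digraph) :
  1 < #|T| -> (forall u v : T, connect (@adj T) u v) ->
  total_2_dominating [set: T].
Proof.
move=> hn conT; apply/andP; split; apply/forall_inP => v; rewrite !inE // => _.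
have [u vu] : exists u, u != v.
  have : 1 < #|[set: T]| by rewrite cardsT.
  case/card_gt1P => u [w [_ _ uw]]; have [uv|] := eqVneq u v; last by exists u.
  by exists w; rewrite -uv eq_sym.
apply/exists_inP; case/connectP: (conT v u) => -[|w s] /=.
  by move=> _ e; rewrite e eqxx in vu.
by case/andP => a _ _; exists w; rewrite // adj_sym.
Qed.

(** The statement cleared of division and subtraction, so that the counting stays in the
    naturals. *)
Lemma directed_tree_gamma_t2 (T : digraph) : directed_tree T -> 1 < #|T| ->
  2 * #|T| + #|end_vertices T| + 2 <= 3 * gamma_t2 T + #|penultimate_vertices T|
  /\ (3 * gamma_t2 T + #|penultimate_vertices T|
        = 2 * #|T| + #|end_vertices T| + 2 <-> Gamma T).
Proof.
move=> [oT [T_gt0 conT acT]] hn.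
have totT := tree_total_2_dominating hn conT.
rewrite /gamma_t2; case: arg_minnP => // S tS Smin.
have [bnd tight] := t2_bound_tight oT acT T_gt0 tS.
split=> //; split=> [/tight tgt|/(Gamma_dominating oT)[S' tS' S'le]].
  exact: tight_Gamma tgt conT.
by have := Smin _ tS'; lia.
Qed.

Import Order.TTheory GRing.Theory Num.Theory.
Local Open Scope ring_scope.

Theorem theorem5 (T : digraph) (hT : directed_tree T) (hn : (2 <= #|T|)%N) :
  let n : rat := #|T|%:R in
  let e : rat := #|end_vertices T|%:R in
  let p : rat := #|penultimate_vertices T|%:R in
  let bound : rat := (2 * n + e - p + 2) / 3 in
  bound <= (gamma_t2 T)%:R /\ ((gamma_t2 T)%:R = bound <-> Gamma T).
Proof.
move=> n e p bound; have [bnd eqG] := directed_tree_gamma_t2 hT hn.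
rewrite -(ler_nat rat) !(natrD, natrM) -/n -/e -/p in bnd.
split; first by rewrite /bound; lra.
rewrite -eqG; split=> h.
  apply/eqP; rewrite -(eqr_nat rat) !(natrD, natrM) -/n -/e -/p h /bound.
  by apply/eqP; lra.
have : (3 * gamma_t2 T + #|penultimate_vertices T|)%:R
     = (2 * #|T| + #|end_vertices T| + 2)%:R :> rat by rewrite h.
by rewrite !(natrD, natrM) -/n -/e -/p /bound => h'; lra.
Qed.
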